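(* Let $x,y$ be the standard generators of $\mathbb{Z}^2$ and let $h$ be the nontrivial element of $\mathbb{Z}_2$. Consider the wreath product $\mathbb{Z}_2\wr\mathbb{Z}^2$ with generating set $S=\{x,y,h\}$. There exists an indexed Cayley automatic representation $\psi: L\to\mathbb{Z}_2\wr\mathbb{Z}^2$ (with respect to $S$) such that $L$ is a regular language.
   Context: Wreath product: for groups $A,B$, let $A^{(B)}$ be the group of functions $B\to A$ with finite support (i.e. $f(x)\neq e$ for only finitely many $x$) under pointwise multiplication. For $f\in A^{(B)}$, $b\in B$ put $f^b(x)=f(bx)$. The restricted wreath product $A\wr B$ is the set of pairs $(f,b)$, $f\in A^{(B)}$, $b\in B$, with multiplication $(f,b)\cdot(f',b')=(f f'^{\,b^{-1}}, bb')$. The group $B$ is identified with the subgroup of elements $(\mathbf{e},b)$, where $\mathbf{e}$ is the identity of $A^{(B)}$; an element $c\in A$ is identified with $(f_c,e)$, where $f_c(e)=c$ and $f_c(x)=e$ for $x\neq e$. Convolution: for a finite alphabet $\Sigma$, let $\Sigma_\diamond=\Sigma\cup\{\diamond\}$ with $\diamond\notin\Sigma$. For $w_1,w_2\in\Sigma^*$, $w_1\otimes w_2$ is the word of length $\max\{|w_1|,|w_2|\}$ over $\Sigma_\diamond\times\Sigma_\diamond$ whose $k$th symbol is $(\sigma_1,\sigma_2)$, where $\sigma_i$ is the $k$th symbol of $w_i$ if $k\leqslant |w_i|$ and $\diamond$ otherwise. Indexed Cayley automatic representation: given a group $G$ and a finite generating set $S\subset G$, an indexed Cayley automatic representation of $G$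 with respect to $S$ is a bijection $\psi:L\to G$, where $L\subset\Sigma^*$ is an indexed language over some finite alphabet $\Sigma$, such that for each $s\in S$ the language $L_s=\{w_1\otimes w_2 \mid w_1,w_2\in L,\ \psi(w_1)s=\psi(w_2)\}$ is indexed. Indexed languages are the languages generated by (Aho's) indexed grammars, equivalently those recognized by nested stack automata. *)

(* Defs.v *)
From HB Require Import structures.
From Stdlib Require Import Relation_Operators.
From mathcomp Require Import all_boot all_order all_algebra.
From mathcomp Require Import finmap classical_sets functions.

Set Implicit Arguments.
Unset Strict Implicit.
Unset Printing Implicit Defensive.

Local Open Scope fset_scope.
Local Open Scope group_scope.

Section FinSupp.
Variables A B : groupType.

Definition fin_supp := {fsfun B -> A with 1}.
Implicit Types f g : fin_supp.

Coercion fin_supp_fun (f : fin_supp) : B -> A := fun_of_fsfun f.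

HB.instance Definition _ := Choice.on fin_supp.

Definition fs_one : fin_supp := [fsfun with 1].

Definition fs_inv f : fin_supp := [fsfun x in finsupp f => (f x)^-1 | 1].

Definition fs_mul f g : fin_supp :=
  [fsfun x in finsupp f `|` finsupp g => f x * g x | 1].

Definition fs_shift f (b : B) : fin_supp :=
  [fsfun x in [fset b^-1 * y | y in finsupp f] => f (b * x) | 1].

Definition fs_single (c : A) : fin_supp := [fsfun x in [fset (1 : B)] => c | 1].

Lemma fs_eqP f g : f =1 g -> f = g.
Proof. exact: (fsfunP f g).1. Qed.

Lemma fs_oneE x : fs_one x = 1.
Proof. exact: fsfun0E. Qed.

Lemma fs_invE f x : fs_inv f x = (f x)^-1.
Proof.
rewrite /fs_inv /fin_supp_fun fsfunE.
by case: finsuppP; rewrite ?invg1.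
Qed.

Lemma fs_mulE f g x : fs_mul f g x = f x * g x.
Proof.
rewrite /fs_mul /fin_supp_fun fsfunE in_fsetU.
by case: (finsuppP f x); case: (finsuppP g x) => //=; rewrite mulg1.
Qed.

Lemma fs_shiftE f b x : fs_shift f b x = f (b * x).
Proof.
rewrite /fs_shift /fin_supp_fun fsfunE.
case: ifPn => // /imfsetP/= nx; symmetry; apply: fsfun_dflt.
by apply/negP => fbx; case: nx; exists (b * x) => //; rewrite mulKg.
Qed.

Lemma fs_singleE c x : fs_single c x = if x == 1 then c else 1.
Proof. by rewrite /fs_single /fin_supp_fun fsfunE in_fset1. Qed.

Lemma fs_mulA : associative fs_mul.
Proof. by move=> f g h; apply: fs_eqP => x; rewrite !fs_mulE mulgA. Qed.

Lemma fs_mul1 : left_id fs_one fs_mul.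
Proof. by move=> f; apply: fs_eqP => x; rewrite fs_mulE fs_oneE mul1g. Qed.

Lemma fs_1mul : right_id fs_one fs_mul.
Proof. by move=> f; apply: fs_eqP => x; rewrite fs_mulE fs_oneE mulg1. Qed.

Lemma fs_mulV : left_inverse fs_one fs_inv fs_mul.
Proof.
by move=> f; apply: fs_eqP => x; rewrite fs_mulE fs_invE fs_oneE mulVg.
Qed.

Lemma fs_Vmul : right_inverse fs_one fs_inv fs_mul.
Proof.
by move=> f; apply: fs_eqP => x; rewrite fs_mulE fs_invE fs_oneE mulgV.
Qed.

HB.instance Definition _ :=
  isGroup.Build fin_supp fs_mulA fs_mul1 fs_1mul fs_mulV fs_Vmul.

Lemma fs_shiftM f g b : fs_shift (f * g) b = fs_shift f b * fs_shift g b.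
Proof. by apply: fs_eqP => x; rewrite !(fs_shiftE, fs_mulE). Qed.

Lemma fs_shift_shift f b c : fs_shift (fs_shift f b) c = fs_shift f (b * c).
Proof. by apply: fs_eqP => x; rewrite !fs_shiftE mulgA. Qed.

Lemma fs_shift1 f : fs_shift f 1 = f.
Proof. by apply: fs_eqP => x; rewrite fs_shiftE mul1g. Qed.

Lemma fs_shift_one b : fs_shift 1 b = 1.
Proof. by apply: fs_eqP => x; rewrite fs_shiftE !fs_oneE. Qed.

Lemma fs_shiftV f b : fs_shift f^-1 b = (fs_shift f b)^-1.
Proof. by apply: fs_eqP => x; rewrite !(fs_shiftE, fs_invE). Qed.

End FinSupp.

Section Wreath.
Variables A B : groupType.

Definition wreath : Type := (fin_supp A B * B)%type.
Implicit Types u v : wreath.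

HB.instance Definition _ := Choice.on wreath.

Definition wr_one : wreath := (1, 1).

Definition wr_mul u v : wreath := (u.1 * fs_shift v.1 u.2^-1, u.2 * v.2).

Definition wr_inv u : wreath := (fs_shift u.1^-1 u.2, u.2^-1).

Lemma wr_mulA : associative wr_mul.
Proof.
by move=> u v w; rewrite /wr_mul /= fs_shiftM fs_shift_shift !mulgA invgM.
Qed.

Lemma wr_mul1 : left_id wr_one wr_mul.
Proof. by case=> f b; rewrite /wr_mul /= invg1 fs_shift1 !mul1g. Qed.

Lemma wr_1mul : right_id wr_one wr_mul.
Proof. by case=> f b; rewrite /wr_mul /= fs_shift_one !mulg1. Qed.

Lemma wr_mulV : left_inverse wr_one wr_inv wr_mul.
Proof.
by case=> f b; rewrite /wr_mul /= invgK -fs_shiftM !mulVg fs_shift_one.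
Qed.

Lemma wr_Vmul : right_inverse wr_one wr_inv wr_mul.
Proof.
by case=> f b; rewrite /wr_mul /= fs_shift_shift !mulgV fs_shift1 mulgV.
Qed.

HB.instance Definition _ :=
  isGroup.Build wreath wr_mulA wr_mul1 wr_1mul wr_mulV wr_Vmul.

Definition wr_base (b : B) : wreath := (1, b).

Definition wr_fiber (c : A) : wreath := (fs_single B c, 1).

End Wreath.

(* The additive groups of 'Z_2 and of int * int, written multiplicatively *)
Definition Z2 : groupType := Algebra.to_multiplicative 'Z_2.
Definition ZZ : groupType := Algebra.to_multiplicative (int * int)%type.

Definition gen_x : wreath Z2 ZZ := wr_base Z2 ((1%R, 0%R) : ZZ).
Definition gen_y : wreath Z2 ZZ := wr_base Z2 ((0%R, 1%R) : ZZ).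
Definition gen_h : wreath Z2 ZZ := wr_fiber ZZ (1%R : Z2).

Definition generates (G : groupType) (S : {fset G}) :=
  forall H : set G,
    H 1 -> (forall u v, H u -> H v -> H (u / v)) ->
    (forall s, s \in S -> H s) -> H = [set: G]%classic.

Definition regular_language (T : finType) (L : set (seq T)) :=
  exists (Q : finType) (delta : Q -> T -> Q) (q0 : Q) (F : pred Q),
    L = [set w | F (foldl delta q0 w)]%classic.

(* Aho's indexed grammars: in [ig_prods] a nonterminal on a right-hand side
   carries a string of flags; [ig_iprods f] lists the index productions that
   consume the flag [f], whose right-hand sides carry no flags. *)
Record indexed_grammar (T : finType) := IndexedGrammar {
  ig_nt : finType;
  ig_flag : finType;
  ig_prods : seq (ig_nt * seq (ig_nt * seq ig_flag + T));
  ig_iprods : ig_flag -> seq (ig_nt * seq (ig_nt + T));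
  ig_start : ig_nt
}.

Section IndexedGrammar.
Variables (T : finType) (g : indexed_grammar T).

Definition ig_form := seq (ig_nt g * seq (ig_flag g) + T).

Definition ig_push (zeta : seq (ig_flag g))
    (X : ig_nt g * seq (ig_flag g) + T) : ig_nt g * seq (ig_flag g) + T :=
  match X with
  | inl (A, eta) => inl (A, eta ++ zeta)
  | inr a => inr a
  end.

Definition ig_distr (zeta : seq (ig_flag g))
    (X : ig_nt g + T) : ig_nt g * seq (ig_flag g) + T :=
  match X with
  | inl A => inl (A, zeta)
  | inr a => inr a
  end.

Inductive ig_step : ig_form -> ig_form -> Prop :=
| ig_step_prod (alpha beta : ig_form) A zeta rhs :
    (A, rhs) \in ig_prods g ->
    ig_step (alpha ++ inl (A, zeta) :: beta)
            (alpha ++ map (ig_push zeta) rhs ++ beta)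
| ig_step_index (alpha beta : ig_form) A f zeta rhs :
    (A, rhs) \in ig_iprods f ->
    ig_step (alpha ++ inl (A, f :: zeta) :: beta)
            (alpha ++ map (ig_distr zeta) rhs ++ beta).

Definition ig_language : set (seq T) :=
  [set w | clos_refl_trans ig_form ig_step
             [:: inl (ig_start g, [::])] (map inr w)]%classic.

End IndexedGrammar.

Definition indexed_language (T : finType) (L : set (seq T)) :=
  exists g : indexed_grammar T, L = ig_language g.

(* [None] is the padding symbol *)
Definition convolution (T : Type) (w1 w2 : seq T) : seq (option T * option T) :=
  mkseq (fun k => (onth w1 k, onth w2 k)) (maxn (size w1) (size w2)).

Definition cayley_language (T : Type) (G : groupType) (L : set (seq T))
    (psi : seq T -> G) (s : G) : set (seq (option T * option T)) :=
  [set w | exists w1 w2, [/\ L w1, L w2, psi w1 * s = psi w2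
                           & w = convolution w1 w2]]%classic.

(* [psi] is total on words; only its restriction to [L] is relevant *)
Definition indexed_cayley_representation (G : groupType) (S : {fset G})
    (T : finType) (L : set (seq T)) (psi : seq T -> G) :=
  [/\ generates S,
      indexed_language L,
      set_bij L [set: G]%classic psi
    & forall s, s \in S -> indexed_language (cayley_language L psi s)].

(* Main.v *)
Require Import Defs.
From HB Require Import structures.
From Stdlib Require Import Relation_Operators.
From mathcomp Require Import all_boot all_order all_algebra.
From mathcomp Require Import finmap classical_sets functions.
From mathcomp Require Import zify.

(** The representation.  The plane is cut into four quadrants, each a copy of
N^2, and N^2 is numbered by [cell a b = 2^a (2b + 1) - 1].  An element (f, z) of
the group is written as the word whose k-th letter records the four values of f
at the points of cell k, one in each quadrant, and, when z is one of these
points, the quadrant of z as a marker.  The word is cut after its last nonempty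
letter, so the words that occur are those with exactly one marker and a nonempty
last letter ([normal_words]): a regular language, in bijection with the group
([word_elt_inj], [word_elt_surj]).

Multiplication by h alters one bit of the marked letter, so its language is
regular.  Multiplication by x or y keeps the bits and moves the marker.  With
the bits checked by a finite automaton, what remains is the pair of marker
positions.  In a quadrant where the move leads away from the axes it is
(a, b) -> (a+1, b), that is n -> 2n+1 on numbers, or (a, b) -> (a, b+1), that
is n -> n + 2^(a+1); in the opposite direction the two markers exchange their
tracks; and a move across an axis keeps the cell, with a = 0 or b = 0.  These
position pairs, drawn as words over the letters no marker, near marker, far
marker, both markers ([skeleton]), are generated by a small indexed grammar: the
first kind is a mirror language, and for the second a stack of a flags makes a
nonterminal produce exactly 2^a - 1 letters by doubling ([skel_grammar],
[indexed_skeleton]).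

The two parts combine because an indexed language stays indexed under inverse
letter maps and intersection with a regular language
([indexed_regular_control]); [indexed_cayley_language] packages this for the
languages of a Cayley automatic representation.  Derivations are handled through
a least fixpoint: the family of languages derived from a nonterminal and a stack
is the smallest one closed under the productions ([derives_min],
[derives_closed]), which turns every statement on derivations into a check of
finitely many productions. *)

Set Implicit Arguments.
Unset Strict Implicit.
Unset Printing Implicit Defensive.

(** * Derivations of indexed grammars as a least fixpoint *)

Section Derivations.
Variables (T : finType) (g : indexed_grammar T).
Notation form := (ig_form g).
Notation interp := (ig_nt g -> seq (ig_flag g) -> seq T -> Prop).
Implicit Types (P : interp) (X Y : form) (w : seq T).

(** The language of a sentential form is the concatenation of the languages of
its symbols, once a language [P A zeta] is given for each nonterminal with its
stack. *)
Fixpoint form_lang P X w : Prop :=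
  match X with
  | [::] => w = [::]
  | inl (A, zeta) :: X' =>
      exists u v, [/\ w = u ++ v, P A zeta u & form_lang P X' v]
  | inr a :: X' => exists2 v, w = a :: v & form_lang P X' v
  end.

Definition closed_interp P :=
  (forall A rhs zeta w, (A, rhs) \in ig_prods g ->
     form_lang P (map (ig_push zeta) rhs) w -> P A zeta w) /\
  (forall A f rhs zeta w, (A, rhs) \in ig_iprods f ->
     form_lang P (map (ig_distr zeta) rhs) w -> P A (f :: zeta) w).

Definition derives : interp := fun A zeta w =>
  clos_refl_trans form (@ig_step T g) [:: inl (A, zeta)] (map inr w).

Lemma form_lang_cat P X Y w :
  form_lang P (X ++ Y) w <->
  exists u v, [/\ w = u ++ v, form_lang P X u & form_lang P Y v].
Proof.
elim: X w => [|[[A zeta]|a] X IH] w /=.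
- by split=> [H|[? [v [-> -> H]]] //]; exists [::], w.
- split=> [[u [? [-> Pu /IH[v1 [v2 [-> H1 H2]]]]]]|].
    by exists (u ++ v1), v2; split; rewrite ?catA //; exists u, v1.
  move=> [? [v [-> [u1 [u2 [-> H1 H2]]] H3]]].
  exists u1, (u2 ++ v); split; rewrite ?catA //.
  by apply/IH; exists u2, v.
- split=> [[? -> /IH[v1 [v2 [-> H1 H2]]]]|].
    by exists (a :: v1), v2; split=> //; exists v1.
  move=> [? [v [-> [u -> H1] H2]]]; exists (u ++ v) => //.
  by apply/IH; exists u, v.
Qed.

Lemma form_lang_terminals P w : form_lang P (map inr w) w.
Proof. by elim: w => //= a w IH; exists w. Qed.

(** A step replaces one symbol inside a concatenation, so closure under the
productions carries words backwards along the step. *)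
Lemma step_form_lang P X Y w : closed_interp P ->
  ig_step X Y -> form_lang P Y w -> form_lang P X w.
Proof.
move=> [Pp Pi] [] alpha beta A.
- move=> zeta rhs rhsP /form_lang_cat[u [? [-> Hu]]].
  move=> /form_lang_cat[v1 [v2 [-> Hv1 Hv2]]].
  apply/form_lang_cat; exists u, (v1 ++ v2); split=> //=.
  by exists v1, v2; split=> //; apply: Pp Hv1.
- move=> f zeta rhs rhsP /form_lang_cat[u [? [-> Hu]]].
  move=> /form_lang_cat[v1 [v2 [-> Hv1 Hv2]]].
  apply/form_lang_cat; exists u, (v1 ++ v2); split=> //=.
  by exists v1, v2; split=> //; apply: Pi Hv1.
Qed.

Lemma derives_min P A zeta w :
  closed_interp P -> derives A zeta w -> P A zeta w.
Proof.
move=> Pcl dw; have: form_lang P [:: inl (A, zeta)] w.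
  have: form_lang P (map inr w) w by apply: form_lang_terminals.
  move: dw; rewrite /derives.
  elim=> [X Y /(step_form_lang Pcl)|//|X Y Z _ IH1 _ IH2 /IH2/IH1]; exact.
by case=> u [v [-> Pu /= ->]]; rewrite cats0.
Qed.

(** Steps are context free at the level of forms: they apply inside any
context, hence derivations of two parts can be run one after the other. *)
Lemma derivation_cat X Y X' Y' :
  clos_refl_trans form (@ig_step T g) X Y ->
  clos_refl_trans form (@ig_step T g) X' Y' ->
  clos_refl_trans form (@ig_step T g) (X ++ X') (Y ++ Y').
Proof.
move=> dX dX'; apply: (rt_trans _ _ _ (Y ++ X')).
  elim: dX => [{}X {}Y|{}X|{}X Z {}Y _ IH1 _ IH2].
  - move=> [] alpha beta A.
      move=> zeta rhs rhsP; rewrite -!catA; apply: rt_step.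
      exact: ig_step_prod.
    move=> f zeta rhs rhsP; rewrite -!catA; apply: rt_step.
    exact: ig_step_index.
  - exact: rt_refl.
  - exact: rt_trans IH2.
elim: dX' => [{}X' {}Y'|{}X'|{}X' Z {}Y' _ IH1 _ IH2].
- move=> [] alpha beta A.
    move=> zeta rhs rhsP; rewrite !(catA Y); apply: rt_step.
    exact: ig_step_prod.
  move=> f zeta rhs rhsP; rewrite !(catA Y); apply: rt_step.
  exact: ig_step_index.
- exact: rt_refl.
- exact: rt_trans IH2.
Qed.

Lemma form_lang_derivation X w : form_lang derives X w ->
  clos_refl_trans form (@ig_step T g) X (map inr w).
Proof.
elim: X w => [|[[A zeta]|a] X IH] w /=.
- by move=> ->; apply: rt_refl.
- move=> [u [v [-> du /IH dv]]]; rewrite map_cat.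
  exact: (derivation_cat du dv).
- move=> [v -> /IH dv]; apply: (@derivation_cat [:: inr a] [:: inr a]) dv.
  exact: rt_refl.
Qed.

Lemma derives_closed : closed_interp derives.
Proof.
split=> [A rhs|A f rhs] zeta w rhsP /form_lang_derivation dw.
  apply: (rt_trans _ _ _ (map (ig_push zeta) rhs)) dw; apply: rt_step.
  by have := @ig_step_prod _ g [::] [::] A zeta rhs rhsP; rewrite /= cats0.
apply: (rt_trans _ _ _ (map (ig_distr zeta) rhs)) dw; apply: rt_step.
by have := @ig_step_index _ g [::] [::] A f zeta rhs rhsP; rewrite /= cats0.
Qed.

End Derivations.

(** * Control of an indexed grammar by a finite automaton *)

Section RegularControl.
Variables (T T' : finType) (proj : T' -> T) (g : indexed_grammar T).
Variables (Q : finType) (delta : Q -> T' -> Q) (q0 : Q) (F : pred Q).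

Section Annotate.
Variables (V V' : Type) (mk : Q -> V -> Q -> V').

(** All ways of threading automaton states through a right-hand side from
[p], choosing for each terminal a letter above it; each comes with its last
state.  [mk] attaches the states to a nonterminal, which carries flags in plain
productions and none in index productions: both are instances. *)
Fixpoint annotate (p : Q) (s : seq (V + T)) : seq (seq (V' + T') * Q) :=
  match s with
  | [::] => [:: ([::], p)]
  | inl x :: s' => flatten
      [seq [seq (inl (mk p x q) :: r.1, r.2) | r <- annotate q s'] | q <- enum Q]
  | inr t :: s' => flatten
      [seq [seq (inr a :: r.1, r.2) | r <- annotate (delta p a) s']
      | a <- enum T' & proj a == t]
  end.
End Annotate.

Definition ctl_nt : finType := option (Q * ig_nt g * Q)%type.

Definition ctl_prods : seq (ctl_nt * seq (ctl_nt * seq (ig_flag g) + T')) :=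
  [seq (None, [:: inl (Some (q0, ig_start g, q), [::])]) | q <- enum F] ++
  flatten [seq [seq (Some (p, r.1, s.2), s.1) |
     s <- annotate (fun p x q => (Some (p, x.1, q) : ctl_nt, x.2)) p r.2] |
     p <- enum Q, r <- ig_prods g].

Definition ctl_iprods (f : ig_flag g) : seq (ctl_nt * seq (ctl_nt + T')) :=
  flatten [seq [seq (Some (p, r.1, s.2), s.1) |
     s <- annotate (fun p x q => Some (p, x, q) : ctl_nt) p r.2] |
     p <- enum Q, r <- ig_iprods f].

(** A nonterminal [Some (p, A, q)] derives the words that [A] derives up to
[proj] and that drive the automaton from [p] to [q].  The intermediate states
along a right-hand side are guessed; the stacks are those of the given grammar.
The start symbol [None] guesses the final state. *)
Definition ctl_grammar : indexed_grammar T' :=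
  @IndexedGrammar T' ctl_nt (ig_flag g) ctl_prods ctl_iprods None.

Notation der := (@derives T g).
Notation der' := (@derives T' ctl_grammar).

Definition ctl_interp (A : ctl_nt) zeta w : Prop :=
  match A with
  | None => F (foldl delta q0 w) /\ der (ig_start g) zeta (map proj w)
  | Some (p, A, q) => foldl delta p w = q /\ der A zeta (map proj w)
  end.

Section AnnotateLang.
Variables (V V' : eqType) (mk : Q -> V -> Q -> V').
Variables (push : V + T -> ig_nt g * seq (ig_flag g) + T).
Variables (push' : V' + T' -> ctl_nt * seq (ig_flag g) + T').
Hypothesis push_inr : forall t, push (inr t) = inr t.
Hypothesis push'_inr : forall t, push' (inr t) = inr t.
Hypothesis pushE : forall x, exists A zeta, push (inl x) = inl (A, zeta) /\
  forall p q, push' (inl (mk p x q)) = inl (Some (p, A, q), zeta).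

Lemma annotate_sound p s r w : r \in annotate mk p s ->
  @form_lang T' ctl_grammar ctl_interp (map push' r.1) w ->
  foldl delta p w = r.2 /\ form_lang der (map push s) (map proj w).
Proof.
elim: s p r w => [|[x|t] s IH] p r w /=.
- by rewrite inE => /eqP-> /= ->.
- have [A [zeta [-> e']]] := pushE x.
  move=> /flatten_mapP[q _ /mapP[r' r's ->]] /=; rewrite e' /=.
  move=> [u [v [-> [eq du] /(IH _ _ _ r's)[ev dv]]]].
  rewrite foldl_cat eq; split=> //; exists (map proj u), (map proj v).
  by rewrite map_cat.
- rewrite push_inr => /flatten_mapP[a]; rewrite mem_filter => /andP[/eqP<- _].
  move=> /mapP[r' r's ->] /=; rewrite push'_inr.
  move=> [v -> /(IH _ _ _ r's)[ev dv]] /=.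
  by split=> //; exists (map proj v).
Qed.

(** The states to guess for a given word are those of its run; the hypothesis
allows any starting state because each nonterminal begins where its
predecessor stops. *)
Lemma annotate_complete p s w :
  form_lang (fun A zeta u => forall w p, map proj w = u ->
     der' (Some (p, A, foldl delta p w)) zeta w) (map push s) (map proj w) ->
  exists2 r, r \in annotate mk p s &
     r.2 = foldl delta p w /\ form_lang der' (map push' r.1) w.
Proof.
elim: s p w => [|[x|t] s IH] p w /=.
- by case: w => // _; exists ([::], p); rewrite ?inE.
- have [A [zeta [-> e']]] := pushE x => /= -[u [v [ew du dv]]].
  have eu : map proj (take (size u) w) = u by rewrite map_take ew take_size_cat.
  have ev : map proj (drop (size u) w) = v by rewrite map_drop ew drop_size_cat.
  rewrite -ev in dv.
  have [r rs [er dr]] := IH (foldl delta p (take (size u) w)) _ dv.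
  exists (inl (mk p x (foldl delta p (take (size u) w))) :: r.1, r.2).
    apply/flatten_mapP; exists (foldl delta p (take (size u) w)).
      by rewrite mem_enum.
    by apply/mapP; exists r.
  split; first by rewrite er -foldl_cat cat_take_drop.
  rewrite /= e' /=; exists (take (size u) w), (drop (size u) w).
  by split=> //; [rewrite cat_take_drop | apply: du].
- rewrite push_inr; case: w => [[]//|a w] /= [_ [<- <-] dv].
  have [r rs [er dr]] := IH (delta p a) _ dv.
  exists (inr a :: r.1, r.2); last by split=> //=; rewrite push'_inr; exists w.
  apply/flatten_mapP; exists a; first by rewrite mem_filter eqxx mem_enum.
  by apply/mapP; exists r.
Qed.

End AnnotateLang.

Lemma ctl_interp_closed : @closed_interp T' ctl_grammar ctl_interp.
Proof.
split=> [A rhs|A f rhs] zeta w /=.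
  rewrite mem_cat => /orP[/mapP[q]|/flattenP[rhs']].
    rewrite mem_enum => Fq [-> ->] /= [u [? [-> [eq du] ->]]].
    by rewrite cats0 /ctl_interp eq.
  move=> /allpairsP[[p r]] /= [_ rg ->] /mapP[s sr [-> ->]].
  set push := ig_push zeta => dw.
  have [] := @annotate_sound _ _ _ (@ig_push _ g zeta)
    _ _ _ _ p r.2 s w sr dw => //.
    by move=> [B eta]; exists B, (eta ++ zeta).
  move=> sw dr; split=> //.
  by apply: (derives_closed g).1 dr; rewrite -surjective_pairing.
move=> /flattenP[rhs'] /allpairsP[[p r]] /= [_ rg ->] /mapP[s sr [-> ->]].
move=> dw.
have [] := @annotate_sound _ _ _ (@ig_distr _ g zeta)
  _ _ _ _ p r.2 s w sr dw => //.
  by move=> B; exists B, zeta.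
move=> sw dr; split=> //.
by apply: (derives_closed g).2 dr; rewrite -surjective_pairing.
Qed.

Lemma derives_ctl A zeta u : der A zeta u -> forall w p, map proj w = u ->
  der' (Some (p, A, foldl delta p w)) zeta w.
Proof.
move=> du; pose P A zeta u := forall w p, map proj w = u ->
  der' (Some (p, A, foldl delta p w)) zeta w.
suff Pcl : closed_interp P by apply: (derives_min (P := P)) du.
clear; split=> [A rhs zeta u rhsP|A f rhs zeta u rhsP] dr w p uE.
  have [||||r rs [<- dr']] := @annotate_complete _ _
    (fun p x q => (Some (p, x.1, q) : ctl_nt, x.2)) (ig_push zeta)
    (@ig_push _ ctl_grammar zeta) _ _ _ p rhs w; rewrite ?uE //.
    by move=> [B eta]; exists B, (eta ++ zeta).
  apply: (derives_closed ctl_grammar).1 dr'.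
  rewrite mem_cat; apply/orP; right; apply/flattenP.
  exists [seq (Some (p, A, s.2), s.1) |
     s <- annotate (fun p x q => (Some (p, x.1, q) : ctl_nt, x.2)) p rhs].
    by apply/allpairsP; exists (p, (A, rhs)); rewrite mem_enum.
  by apply/mapP; exists r.
have [||||r rs [<- dr']] := @annotate_complete _ _
  (fun p x q => Some (p, x, q) : ctl_nt) (ig_distr zeta)
  (@ig_distr _ ctl_grammar zeta) _ _ _ p rhs w; rewrite ?uE //.
  by move=> B; exists B, zeta.
apply: (derives_closed ctl_grammar).2 dr'.
apply/flattenP.
exists [seq (Some (p, A, s.2), s.1) |
   s <- annotate (fun p x q => Some (p, x, q) : ctl_nt) p rhs].
  by apply/allpairsP; exists (p, (A, rhs)); rewrite mem_enum.
by apply/mapP; exists r.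
Qed.

Lemma ctl_grammarP w : ig_language ctl_grammar w <->
  F (foldl delta q0 w) /\ ig_language g (map proj w).
Proof.
split=> [/(derives_min ctl_interp_closed)//|[Fw dw]].
apply: ((derives_closed ctl_grammar).1 None
  [:: inl (Some (q0, ig_start g, foldl delta q0 w), [::])]); last first.
  exists w, [::]; rewrite cats0; split=> //.
  exact: (derives_ctl dw q0 (erefl _)).
rewrite mem_cat; apply/orP; left; apply/mapP.
by exists (foldl delta q0 w); rewrite ?mem_enum.
Qed.

End RegularControl.

(** Inverse letter maps and regular intersection are treated at once, since
this is the form in which the closure is used. *)
Lemma indexed_regular_control (T T' : finType) (proj : T' -> T)
    (K : set (seq T)) (R : set (seq T')) :
  indexed_language K -> regular_language R ->
  indexed_language [set w | R w /\ K (map proj w)]%classic.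
Proof.
move=> [g ->] [Q [delta [q0 [F ->]]]].
exists (ctl_grammar proj g delta q0 F); apply/seteqP.
by split=> w; rewrite /= ctl_grammarP.
Qed.

(** * Regular languages *)

Lemma regular_setI (T : finType) (R1 R2 : set (seq T)) :
  regular_language R1 -> regular_language R2 ->
  regular_language [set w | R1 w /\ R2 w]%classic.
Proof.
move=> [Q1 [d1 [i1 [F1 ->]]]] [Q2 [d2 [i2 [F2 ->]]]].
exists (Q1 * Q2)%type, (fun q t => (d1 q.1 t, d2 q.2 t)), (i1, i2).
exists (fun q => F1 q.1 && F2 q.2); apply/seteqP.
have run w q : foldl (fun q t => (d1 q.1 t, d2 q.2 t)) q w =
    (foldl d1 q.1 w, foldl d2 q.2 w).
  by elim: w q => [[]//|t w IH] q /=; rewrite IH.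
by split=> w /=; rewrite run => /andP.
Qed.

Lemma regular_letter_preimage (T T' : finType) (f : T' -> T)
    (R : set (seq T)) :
  regular_language R -> regular_language [set w | R (map f w)]%classic.
Proof.
move=> [Q [d [i [F ->]]]]; exists Q, (fun q t => d q (f t)), i, F.
have run w q : foldl d q (map f w) = foldl (fun q t => d q (f t)) q w.
  by elim: w q => //= t w IH q; rewrite IH.
by apply/seteqP; split=> w /=; rewrite run.
Qed.

(** The automaton remembers the set of parameters that have not failed yet. *)
Lemma regular_exists_all (T I : finType) (p : I -> pred T) :
  regular_language [set w | exists i, all (p i) w]%classic.
Proof.
pose d (Q : {ffun I -> bool}) t : {ffun I -> bool} := [ffun i => Q i && p i t].
exists {ffun I -> bool}, d, [ffun=> true].
exists (fun Q : {ffun I -> bool} => [exists i, Q i]).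
have run w Q i : foldl d Q w i = Q i && all (p i) w.
  elim: w Q => [|t w IH] Q /=; first by rewrite andbT.
  by rewrite IH ffunE andbA.
apply/seteqP; split=> w /=.
  by move=> [i wi]; apply/existsP; exists i; rewrite run ffunE.
by move=> /existsP[i]; rewrite run ffunE; exists i.
Qed.

(** The state [None] means that two letters have been counted. *)
Lemma regular_count1 (T : finType) (a : pred T) :
  regular_language [set w | count a w == 1]%classic.
Proof.
pose d s t := if a t then (if s is Some false then Some true else None) else s.
exists (option bool), d, (Some false), (pred1 (Some true)).
have run0 w : foldl d None w = None.
  by elim: w => //= t w IH; rewrite /d; case: (a t).
have run1 w : (foldl d (Some true) w == Some true) = (count a w == 0).
  by elim: w => //= t w IH; rewrite {2}/d; case: (a t); rewrite ?run0 ?IH.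
have run w : (foldl d (Some false) w == Some true) = (count a w == 1).
  by elim: w => //= t w IH; rewrite {2}/d; case: (a t); rewrite ?run1 ?IH.
by apply/seteqP; split=> w /=; rewrite run.
Qed.

Lemma regular_last (T : finType) (x0 : T) (p : pred T) :
  regular_language [set w | p (last x0 w)]%classic.
Proof.
exists T, (fun _ t => t), x0, p.
have run w x : foldl (fun _ t => t) x w = last x w by elim: w x => /=.
by apply/seteqP; split=> w /=; rewrite run.
Qed.

(** * Languages of convolutions *)

Definition padding (T : finType) (w : seq T) n : seq (option T) :=
  map Some w ++ nseq n None.

(** The boolean of a state tells whether the padding has begun; a letter after
the padding leads to the failure state [None]. *)
Lemma regular_padding (T : finType) (R : set (seq T)) :
  regular_language R ->
  regular_language [set u | exists w n, R w /\ u = padding w n]%classic.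
Proof.
move=> [Q [d [i [F ->]]]].
pose dp (s : option (Q * bool)) (t : option T) :=
  match s, t with
  | Some (q, false), Some t => Some (d q t, false)
  | Some (q, _), None => Some (q, true)
  | _, _ => None
  end.
pose Fp (s : option (Q * bool)) := if s is Some (q, _) then F q else false.
exists (option (Q * bool)%type), dp, (Some (i, false)), Fp.
have run0 u : foldl dp None u = None by elim: u.
have run1 q u : Fp (foldl dp (Some (q, true)) u) ->
    F q /\ u = nseq (size u) None.
  elim: u => [|[t|] u IH] //=; first by rewrite run0.
  by move=> /IH[Fq {1}->].
have run q u : Fp (foldl dp (Some (q, false)) u) ->
    exists w n, F (foldl d q w) /\ u = padding w n.
  elim: u q => [|[t|] u IH] q /=; first by exists [::], 0.
    by move=> /IH[w [n [Fw ->]]]; exists (t :: w), n.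
  by move=> /run1[Fq ->]; exists [::], (size u).+1.
apply/seteqP; split=> u /=; last exact: run.
move=> [w [n [Fw ->]]]; elim: w i Fw => [|t w IH] q /=; last exact: IH.
move=> Fq.
have run2 k b : foldl dp (Some (q, b)) (nseq k.+1 None) = Some (q, true).
  by elim: k b => [|k IH] b; [case: b | rewrite -(IH true); case: b].
by case: n => // n; rewrite /padding cat0s run2.
Qed.

Lemma size_padding (T : finType) (w : seq T) n :
  size (padding w n) = size w + n.
Proof. by rewrite size_cat size_map size_nseq. Qed.

Lemma nth_padding (T : finType) (w : seq T) n i :
  nth None (padding w n) i = onth w i.
Proof.
rewrite nth_cat size_map onthE nth_nseq if_same.
by case: ltnP => // le_wi; rewrite nth_default ?size_map.
Qed.

(** The lengths are forced: two nonempty paddings would end in the excluded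
letter [(None, None)].  Each of the three conditions is regular. *)
Lemma convolutionP (T : finType) (w1 w2 : seq T) w :
  w = convolution w1 w2 <->
  [/\ exists n, map fst w = padding w1 n, exists n, map snd w = padding w2 n
    & (None, None) \notin w].
Proof.
split=> [->|[[n1 e1] [n2 e2] nw]].
  split.
  - exists (maxn (size w1) (size w2) - size w1).
    apply: (@eq_from_nth _ None) => [|k].
      by rewrite size_padding size_map size_mkseq subnKC ?leq_maxl.
    rewrite size_map size_mkseq => lt_k.
    by rewrite (nth_map (None, None)) ?size_mkseq // nth_mkseq // nth_padding.
  - exists (maxn (size w1) (size w2) - size w2).
    apply: (@eq_from_nth _ None) => [|k].
      by rewrite size_padding size_map size_mkseq subnKC ?leq_maxr.
    rewrite size_map size_mkseq => lt_k.
    by rewrite (nth_map (None, None)) ?size_mkseq // nth_mkseq // nth_padding.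
  - apply/negP => /mapP[k]; rewrite mem_iota add0n /= => lt_k [].
    move=> /(congr1 isSome) + /(congr1 isSome); rewrite !onthTE /=.
    by lia.
have szw : size w = maxn (size w1) (size w2).
  have s1 : size w = size w1 + n1 by rewrite -size_padding -e1 size_map.
  have s2 : size w = size w2 + n2 by rewrite -size_padding -e2 size_map.
  suff: ~ (0 < n1 /\ 0 < n2) by lia.
  move=> [n1_gt0 n2_gt0].
  (* two nonempty paddings would meet in the last letter *)
  have last_k : (size w).-1 < size w by lia.
  have := mem_nth (None, None) last_k; rewrite [nth _ _ _]surjective_pairing.
  rewrite -!(nth_map _ None) // e1 e2 !nth_padding !onth_default;
    rewrite ?(negPf nw) //; lia.
apply: (@eq_from_nth _ (None, None)); first by rewrite size_mkseq.
move=> k lt_k; rewrite nth_mkseq -?szw // -(nth_padding w1 n1) -e1.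
rewrite -(nth_padding w2 n2) -e2 !(nth_map (None, None)) //.
exact: surjective_pairing.
Qed.

(** To prove [cayley_language L psi s] indexed it suffices to describe
right multiplication by [s], for words of [L] only, by a local condition on the
letters of the convolution, up to a finite parameter [i], together with an
indexed condition on a letterwise image; the format of the convolution is
regular. *)
Lemma indexed_cayley_language (G : groupType) (T M I : finType)
    (L : set (seq T)) (psi : seq T -> G) (s : G)
    (p : I -> pred (option T * option T)) (proj : option T * option T -> M)
    (K : set (seq M)) :
  regular_language L -> indexed_language K ->
  (forall w1 w2, L w1 -> L w2 ->
     let w := convolution w1 w2 in
     (psi w1 * s)%g = psi w2 <-> (exists i, all (p i) w) /\ K (map proj w)) ->
  indexed_language (cayley_language L psi s).
Proof.
move=> Lreg Kind LK.
pose P := [set u | exists w n, L w /\ u = padding w n]%classic.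
have Preg : regular_language P by exact: regular_padding.
pose R := [set w | (P (map fst w) /\ P (map snd w)) /\
  exists i, all [pred a | p i a && (a != (None, None))] w]%classic.
have Rreg : regular_language R.
  by do 2?[apply: regular_setI]; do ?[exact: regular_letter_preimage];
    exact: regular_exists_all.
have := indexed_regular_control proj Kind Rreg.
congr indexed_language; apply/seteqP; split=> w /=.
  move=> [[[[w1 [n1 [Lw1 e1]]] [w2 [n2 [Lw2 e2]]]] [i wi]] Kw].
  have ew : w = convolution w1 w2.
    apply/convolutionP; split; [by exists n1|by exists n2|].
    by apply/negP => /(allP wi); rewrite /= andbF.
  exists w1, w2; split=> //; apply/LK => //; rewrite -ew; split=> //.
  by exists i; apply: sub_all wi => a /andP[].
move=> [w1 [w2 [Lw1 Lw2 /LK-/(_ Lw1 Lw2)[[i wi] Kw] ew]]].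
have /convolutionP[[n1 e1] [n2 e2] nw] := ew.
split; last by rewrite ew.
split; first by split; [exists w1, n1|exists w2, n2].
exists i; apply/allP => a aw /=; rewrite (allP wi) -?ew //=.
by apply: contraNneq nw => <-.
Qed.

(** * A numbering of the quarter plane *)

(** The factor [2 ^ a] and the odd part of a positive number determine each
other freely, hence a bijection from pairs to numbers for which a unit step in
either coordinate has a simple effect, see [cellSl] and [cellSr]. *)
Definition cell (a b : nat) : nat := (2 ^ a * b.*2.+1).-1.

Lemma cellE a b : (cell a b).+1 = 2 ^ a * b.*2.+1.
Proof. by rewrite prednK // muln_gt0 expn_gt0. Qed.

Lemma cellSl a b : cell a.+1 b = (cell a b).*2.+1.
Proof. by apply: succn_inj; rewrite -doubleS !cellE expnS -mulnA mul2n. Qed.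

Lemma cellSr a b : cell a b.+1 = (cell a b + (cell a 0).*2).+2.
Proof.
have := cellE a b.+1; have := cellE a b; have := cellE a 0.
rewrite doubleS !mulnS; lia.
Qed.

Definition uncell (n : nat) : nat * nat :=
  let a := logn 2 n.+1 in (a, (n.+1 %/ 2 ^ a)./2).

(** [cell a b].+1 has 2-adic valuation [a] and odd part [b.*2.+1]. *)
Lemma cellK a b : uncell (cell a b) = (a, b).
Proof.
have lg : logn 2 (cell a b).+1 = a.
  rewrite cellE lognM ?expn_gt0 // pfactorK // lognE /= dvdn2 /= odd_double.
  by rewrite addn0.
by rewrite /uncell lg cellE mulKn ?expn_gt0 //= uphalf_double.
Qed.

Lemma uncellK n : cell (uncell n).1 (uncell n).2 = n.
Proof.
apply: succn_inj; rewrite cellE /=.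
have [m m2 nE] := pfactor_coprime (isT : prime 2) (ltn0Sn n).
move: (logn 2 n.+1) nE => l nE.
have -> : n.+1 %/ 2 ^ l = m by rewrite nE mulnK ?expn_gt0.
rewrite nE mulnC; congr (_ * _).
by rewrite -[RHS]odd_double_half -coprime2n m2.
Qed.

(** * Indexed grammars for pairs of neighbouring cells *)

(** Either the cell [j] is the outer neighbour of [i] in the direction chosen
by [d] (vertical when true), or [i = j] touches the axis that a step in this
direction crosses. *)
Definition grid_step (d : bool) (i j : nat) : Prop :=
  exists a b, i = cell a b /\
    (j = (if d then cell a b.+1 else cell a.+1 b) \/
     j = i /\ (if d then b else a) = 0).

Definition marks (i j n : nat) : seq (bool * bool) :=
  mkseq (fun m => (m == i, m == j)) n.

(** Letters tell whether their position carries the near and the far marker.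
A skeleton keeps of a pair of words only the two marker positions. *)
Definition skeleton (E : nat -> nat -> Prop) : set (seq (bool * bool)) :=
  [set w | exists i j n, [/\ E i j, i < n, j < n & w = marks i j n]]%classic.

Notation blank n := (nseq n (false, false)).

Lemma marks_blank i j s n :
  (forall m, s <= m < s + n -> (m != i) && (m != j)) ->
  [seq (m == i, m == j) | m <- iota s n] = blank n.
Proof.
elim: n s => //= n IH s H; rewrite IH => [|m Hm]; last by apply: H; lia.
by have /andP[/negPf-> /negPf->] := H s ltac:(lia).
Qed.

Lemma marks_pair n m k :
  blank n ++ (true, false) :: blank m ++ (false, true) :: blank k =
  marks n (n + m).+1 (n + m + k).+2.
Proof.
have -> : (n + m + k).+2 = n + (m + k.+1).+1 by lia.
rewrite /marks /mkseq iotaD map_cat /= marks_blank; last by move=> ?; lia.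
rewrite add0n iotaD map_cat /= !marks_blank; try by move=> ?; lia.
by rewrite eqxx !addSn eqxx; do ![rewrite (_ : (_ == _) = false); last lia].
Qed.

Lemma marks_single n k :
  blank n ++ (true, true) :: blank k = marks n n (n + k).+1.
Proof.
rewrite -addnS /marks /mkseq iotaD map_cat /= !marks_blank ?add0n ?eqxx //;
  by move=> ?; lia.
Qed.

(** [Mirror] generates n blanks, a near marker and n blanks; [Pow], under a
stack of a flags, [2 ^ a - 1] blanks, and [Odds] under the same stack
[cell a b] blanks for some b.  [VertN] pushes the flags that fix a. *)
Inductive skel_nt := Rest | Horiz | Mirror | Even | Vert | VertN | Odds | Pow.

Definition skel_code (A : skel_nt) : 'I_8 :=
  match A with
  | Rest => @Ordinal 8 0 isT | Horiz => @Ordinal 8 1 isT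
  | Mirror => @Ordinal 8 2 isT | Even => @Ordinal 8 3 isT
  | Vert => @Ordinal 8 4 isT | VertN => @Ordinal 8 5 isT
  | Odds => @Ordinal 8 6 isT | Pow => @Ordinal 8 7 isT
  end.
Definition skel_decode (k : 'I_8) : skel_nt :=
  nth Rest [:: Rest; Horiz; Mirror; Even; Vert; VertN; Odds; Pow] k.
Lemma skel_codeK : cancel skel_code skel_decode.
Proof. by case. Qed.
HB.instance Definition _ := Finite.copy skel_nt (can_type skel_codeK).

(** The flag [false] is pushed once, at the bottom of the stack: plain
productions ignore the stack, so an index production on a bottom flag is what
allows [Pow] to stop only on the empty tally. *)
Definition skel_prods : seq (skel_nt * seq (skel_nt * seq bool + bool * bool)) :=
  let N A := inl (A, [::]) in
  let o := inr (false, false) in let near := inr (true, false) in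
  let far := inr (false, true) in let both := inr (true, true) in
  [:: (Rest, [::]);
      (Rest, [:: o; N Rest]);
      (Horiz, [:: N Mirror; far; N Rest]);
      (Horiz, [:: N Even; both; N Rest]);
      (Mirror, [:: near]);
      (Mirror, [:: o; N Mirror; o]);
      (Even, [::]);
      (Even, [:: o; o; N Even]);
      (Vert, [:: inl (VertN, [:: false])]);
      (VertN, [:: inl (VertN, [:: true])]);
      (VertN, [:: N Odds; near; N Pow; o; N Pow; far; N Rest]);
      (VertN, [:: N Pow; both; N Rest]);
      (Odds, [:: N Pow]);
      (Odds, [:: N Odds; o; N Pow; o; N Pow])].

(** Each flag doubles: [cell a.+1 0 = 2 * cell a 0 + 1]. *)
Definition skel_iprods (f : bool) : seq (skel_nt * seq (skel_nt + bool * bool)) :=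
  if f then [:: (Pow, [:: inl Pow; inr (false, false); inl Pow])]
  else [:: (Pow, [::])].

Definition skel_grammar (S : skel_nt) : indexed_grammar (bool * bool)%type :=
  @IndexedGrammar (bool * bool)%type skel_nt bool skel_prods skel_iprods S.

Definition tally (a : nat) : seq bool := nseq a true ++ [:: false].

(** The intended language of each nonterminal; on stacks that are not tallies
nothing is claimed. *)
Definition skel_sem (A : skel_nt) (zeta : seq bool) (w : seq (bool * bool)) :=
  match A with
  | Rest => exists k, w = blank k
  | Horiz => skeleton (grid_step false) w
  | Mirror => exists n, w = blank n ++ (true, false) :: blank n
  | Even => exists n, w = blank n.*2
  | Vert => zeta = [::] -> skeleton (grid_step true) w
  | VertN => forall a, zeta = tally a -> skeleton (grid_step true) w
  | Odds => forall a, zeta = tally a -> exists b, w = blank (cell a b)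
  | Pow => forall a, zeta = tally a -> w = blank (cell a 0)
  end.

Lemma skel_single d a b k : (if d then b else a) = 0 ->
  skeleton (grid_step d) (blank (cell a b) ++ (true, true) :: blank k).
Proof.
move=> ab0; exists (cell a b), (cell a b), (cell a b + k).+1.
by rewrite marks_single; split; [exists a, b; split; [|right]|lia|lia|].
Qed.

Lemma skel_horiz a b k : skeleton (grid_step false)
  (blank (cell a b) ++ (true, false) :: blank (cell a b) ++
   (false, true) :: blank k).
Proof.
have E : cell a.+1 b = (cell a b + cell a b).+1 by rewrite cellSl addnn.
rewrite marks_pair -E; exists (cell a b), (cell a.+1 b), (cell a.+1 b + k).+1.
by split; [exists a, b; auto|lia|lia|rewrite E].
Qed.

Lemma skel_vert a b k : skeleton (grid_step true)
  (blank (cell a b) ++ (true, false) :: blank (cell a 0).*2.+1 ++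
   (false, true) :: blank k).
Proof.
have E : cell a b.+1 = (cell a b + (cell a 0).*2.+1).+1 by rewrite cellSr addnS.
rewrite marks_pair -E; exists (cell a b), (cell a b.+1), (cell a b.+1 + k).+1.
by split; [exists a, b; auto|lia|lia|rewrite E].
Qed.

Lemma cell0l b : cell 0 b = b.*2.
Proof. by rewrite /cell mul1n. Qed.

Lemma blank_join m n s :
  blank m ++ (false, false) :: blank n ++ s = blank (m + n).+1 ++ s.
Proof. by rewrite -addnS nseqD -catA. Qed.

Lemma skel_sem_closed S : @closed_interp _ (skel_grammar S) skel_sem.
Proof.
split=> [A rhs zeta w|A [] rhs zeta w]; last first.
- by rewrite inE => /eqP[-> ->] /= -> [|a] // _; rewrite /cell.
- rewrite inE => /eqP[-> ->] /= [u [? [-> Du [? -> [v [? [-> Dv ->]]]]]]] [//|a].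
  move=> [eq]; rewrite (Du a) // (Dv a) // cellSl -addnn.
  by rewrite blank_join cats0.
rewrite [ig_prods _]/= !inE => rhsP; move: rhsP.
do !case/orP; move=> /eqP[-> ->] /=.
- by move=> ->; exists 0.
- by move=> [? -> [? [? [-> [k ->] ->]]]]; exists k.+1; rewrite cats0.
- move=> [? [? [-> [n ->] [? -> [? [? [-> [k ->] ->]]]]]]].
  rewrite -(uncellK n) cats0 -catA /=; exact: skel_horiz.
- move=> [? [? [-> [n ->] [? -> [? [? [-> [k ->] ->]]]]]]].
  by rewrite cats0 -cell0l; apply: skel_single.
- by move=> [? -> ->]; exists 0.
- move=> [? -> [? [? [-> [n ->] [? -> ->]]]]]; exists n.+1.
  by rewrite -catA /= -[[:: _]]/(blank 1) -nseqD addn1.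
- by move=> ->; exists 0.
- by move=> [? -> [? -> [? [? [-> [n ->] ->]]]]]; exists n.+1; rewrite cats0.
- by move=> [u [? [-> Hu ->]]] z0; rewrite cats0; apply: (Hu 0); rewrite z0.
- by move=> [u [? [-> Hu ->]]] a za; rewrite cats0; apply: (Hu a.+1); rewrite za.
- move=> [u [? [-> Hu [? -> [v [? [-> Hv [? -> H]]]]]]]] a za.
  move: H => [v' [? [-> Hv' [? -> [? [? [-> [k ->] ->]]]]]]].
  have [b ->] := Hu a za; rewrite (Hv a za) (Hv' a za) cats0 blank_join.
  by rewrite addnn; apply: skel_vert.
- move=> [u [? [-> Hu [? -> [? [? [-> [k ->] ->]]]]]]] a za.
  by rewrite (Hu a za) cats0; apply: skel_single.
- by move=> [u [? [-> Hu ->]]] a za; exists 0; rewrite (Hu a za) cats0.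
- move=> [u [? [-> Hu [? -> [v [? [-> Hv [? -> [v' [? [-> Hv' ->]]]]]]]]]]] a za.
  have [b ->] := Hu a za; exists b.+1; rewrite (Hv a za) (Hv' a za).
  by rewrite !blank_join cats0 cellSr -addnn addSn addnA.
Qed.

Section Completeness.
Variable S : skel_nt.
Notation der A := (@derives _ (skel_grammar S) A).
Notation lang := (@form_lang _ (skel_grammar S) (@derives _ (skel_grammar S))).

Lemma der_prod A i zeta w : (A, i) \in skel_prods ->
  lang (map (@ig_push _ (skel_grammar S) zeta) i) w -> der A zeta w.
Proof. exact: (derives_closed (skel_grammar S)).1. Qed.

Lemma lang_nonterminal A zeta u X v : der A zeta u -> lang X v ->
  lang (inl (A, zeta) :: X) (u ++ v).
Proof. by exists u, v. Qed.

Lemma lang_terminal t X v : lang X v -> lang (inr t :: X) (t :: v).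
Proof. by exists v. Qed.

Lemma lang_last_nt A zeta u : der A zeta u -> lang [:: inl (A, zeta)] u.
Proof. by move=> du; rewrite -[u]cats0; apply: lang_nonterminal. Qed.

Lemma der_rest zeta k : der Rest zeta (blank k).
Proof.
elim: k => [|k IH]; first by apply: (der_prod (i := [::])).
apply: (der_prod (i := [:: inr (false, false); inl (Rest, [::])])) => //.
exact/lang_terminal/lang_last_nt.
Qed.

Lemma der_mirror zeta n : der Mirror zeta (blank n ++ (true, false) :: blank n).
Proof.
elim: n => [|n IH].
  by apply: (der_prod (i := [:: inr (true, false)])) => //; apply: lang_terminal.
apply: (der_prod (i := [:: inr (false, false); inl (Mirror, [::]);
                           inr (false, false)])) => //.
have -> : blank n.+1 ++ (true, false) :: blank n.+1 =
    (false, false) :: (blank n ++ (true, false) :: blank n) ++ blank 1.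
  by rewrite -catA cat_cons -nseqD addn1.
by apply: lang_terminal; apply: lang_nonterminal => //; apply: lang_terminal.
Qed.

Lemma der_even zeta n : der Even zeta (blank n.*2).
Proof.
elim: n => [|n IH]; first by apply: (der_prod (i := [::])).
apply: (der_prod (i := [:: inr (false, false); inr (false, false);
                           inl (Even, [::])])) => //.
exact/lang_terminal/lang_terminal/lang_last_nt.
Qed.

Lemma der_pow a : der Pow (tally a) (blank (cell a 0)).
Proof.
elim: a => [|a IH].
  by apply: ((derives_closed (skel_grammar S)).2 Pow false [::]).
apply: ((derives_closed (skel_grammar S)).2 Pow true
  [:: inl Pow; inr (false, false); inl Pow]) => //.
rewrite cellSl -addnn -addnS nseqD; apply: lang_nonterminal => //.
exact/lang_terminal/lang_last_nt.
Qed.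

Lemma der_odds a b : der Odds (tally a) (blank (cell a b)).
Proof.
elim: b => [|b IH].
  apply: (der_prod (i := [:: inl (Pow, [::])])) => //.
  exact/lang_last_nt/der_pow.
apply: (der_prod (i := [:: inl (Odds, [::]); inr (false, false);
  inl (Pow, [::]); inr (false, false); inl (Pow, [::])])) => //.
have -> : cell a b.+1 = cell a b + (cell a 0 + (cell a 0).+1).+1.
  by rewrite cellSr; lia.
rewrite nseqD [blank _.+1]/= nseqD.
apply: lang_nonterminal => //; apply: lang_terminal.
apply: lang_nonterminal; first exact: der_pow.
exact/lang_terminal/lang_last_nt/der_pow.
Qed.

(** Pushing is a production of [VertN], so the number of flags is chosen before
any letter is produced. *)
Lemma der_vertn a w : der VertN (tally a) w -> der VertN (tally 0) w.
Proof.
elim: a => // a IH dw; apply: IH.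
apply: (der_prod (i := [:: inl (VertN, [:: true])])) => //.
exact: lang_last_nt.
Qed.

End Completeness.

Lemma marks_blank_pair i j n : i < j < n -> marks i j n =
  blank i ++ (true, false) :: blank (j - i.+1) ++
  (false, true) :: blank (n - j.+1).
Proof. by move=> lt; rewrite marks_pair; congr marks; lia. Qed.

Lemma marks_blank_single i n : i < n ->
  marks i i n = blank i ++ (true, true) :: blank (n - i.+1).
Proof. by move=> lt; rewrite marks_single; congr marks; lia. Qed.

Lemma skel_horizE : ig_language (skel_grammar Horiz) = skeleton (grid_step false).
Proof.
apply/seteqP; split=> w; first exact: (derives_min (skel_sem_closed Horiz)).
move=> [i [j [n [[a [b [-> ]]] ij]]]].
have E := cellSl a b.
case: ij => [->|[-> ->]] lt_i lt_j ->.
  rewrite marks_blank_pair; last by lia.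
  apply: (der_prod (i := [:: inl (Mirror, [::]); inr (false, true);
    inl (Rest, [::])])) => //.
  have -> : cell a.+1 b - (cell a b).+1 = cell a b by lia.
  rewrite -cat_cons catA; apply: lang_nonterminal; first exact: der_mirror.
  exact/lang_terminal/lang_last_nt/der_rest.
rewrite marks_blank_single // cell0l.
apply: (der_prod (i := [:: inl (Even, [::]); inr (true, true);
    inl (Rest, [::])])) => //.
apply: lang_nonterminal; first exact: der_even.
exact/lang_terminal/lang_last_nt/der_rest.
Qed.

Lemma skel_vertE : ig_language (skel_grammar Vert) = skeleton (grid_step true).
Proof.
apply/seteqP; split=> w.
  by move=> /(derives_min (skel_sem_closed Vert)); apply.
move=> [i [j [n [[a [b [-> ]]] ij]]]] lt_i lt_j ->.
apply: (der_prod (i := [:: inl (VertN, [:: false])])) => //.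
apply/lang_last_nt/(@der_vertn _ a).
have E := cellSr a b.
case: ij lt_i lt_j => [->|[-> ->]] lt_i lt_j.
  rewrite marks_blank_pair; last by lia.
  apply: (der_prod (i := [:: inl (Odds, [::]); inr (true, false);
    inl (Pow, [::]); inr (false, false); inl (Pow, [::]); inr (false, true);
    inl (Rest, [::])])) => //.
  have -> : cell a b.+1 - (cell a b).+1 = cell a 0 + (cell a 0).+1 by lia.
  rewrite nseqD -catA cat_cons.
  apply: lang_nonterminal; first exact: der_odds.
  apply: lang_terminal; apply: lang_nonterminal; first exact: der_pow.
  apply: lang_terminal; apply: lang_nonterminal; first exact: der_pow.
  exact/lang_terminal/lang_last_nt/der_rest.
rewrite marks_blank_single //.
apply: (der_prod (i := [:: inl (Pow, [::]); inr (true, true);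
    inl (Rest, [::])])) => //.
apply: lang_nonterminal; first exact: der_pow.
exact/lang_terminal/lang_last_nt/der_rest.
Qed.

Lemma indexed_skeleton d : indexed_language (skeleton (grid_step d)).
Proof.
case: d; first by exists (skel_grammar Vert); rewrite skel_vertE.
by exists (skel_grammar Horiz); rewrite skel_horizE.
Qed.

(** Letterwise, every word lies over a blank word, and the grammar of blank
words can be controlled by any automaton. *)
Lemma regular_indexed (T : finType) (R : set (seq T)) :
  regular_language R -> indexed_language R.
Proof.
move=> Rreg.
have K : indexed_language (ig_language (skel_grammar Rest)).
  by exists (skel_grammar Rest).
have := indexed_regular_control (fun=> (false, false)) K Rreg.
congr indexed_language; apply/seteqP; split=> w; first by case.
split=> //=; have -> : [seq (false, false) | _ <- w] = blank (size w).
  by elim: {+}w => //= t v ->.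
exact: der_rest.
Qed.

(** * Words for the elements of the wreath product *)

Local Notation quadrant := (bool * bool)%type.

Definition fold_int (i : int) : nat * bool :=
  match i with Posz a => (a, false) | Negz a => (a, true) end.
Definition unfold_int (p : nat * bool) : int :=
  if p.2 then Negz p.1 else Posz p.1.

(** The sign of a coordinate is the constructor of the integer, so that -1 is
the mirror image of 0 and the four quadrants are disjoint. *)
Definition site (z : ZZ) : nat * quadrant :=
  (cell (fold_int z.1).1 (fold_int z.2).1,
   ((fold_int z.1).2, (fold_int z.2).2)).

Definition unsite (p : nat * quadrant) : ZZ :=
  (unfold_int ((uncell p.1).1, p.2.1), unfold_int ((uncell p.1).2, p.2.2)).

Lemma siteK : cancel site unsite.
Proof. by move=> [[i|i] [j|j]]; rewrite /unsite /site !cellK. Qed.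

Lemma unfold_intK : cancel unfold_int fold_int.
Proof. by move=> [a []]. Qed.

Lemma unsiteK : cancel unsite site.
Proof. by move=> [k [s t]]; rewrite /site !unfold_intK uncellK. Qed.

(** The bits at the four points of a cell, and the quadrant of the marker if
the cell holds it. *)
Definition letter : finType := ({ffun quadrant -> 'Z_2} * option quadrant)%type.
Definition empty_letter : letter := ([ffun=> 0%R], None).
Definition letter_at (w : seq letter) (k : nat) : letter := nth empty_letter w k.

Definition marked (l : letter) : bool := l.2.

Definition normal_words : set (seq letter) :=
  [set w | count marked w == 1 /\ last empty_letter w != empty_letter]%classic.

Definition marker (w : seq letter) : nat * quadrant :=
  let k := find marked w in (k, odflt (false, false) (letter_at w k).2).

Definition marked_at (w : seq letter) (p : nat * quadrant) : Prop :=
  forall k, (letter_at w k).2 = if k == p.1 then Some p.2 else None.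

Lemma unmarkedP (w : seq letter) :
  count marked w == 0 <-> forall k, (letter_at w k).2 = None.
Proof.
elim: w => [|l w IH] /=; first by split=> // _ k; rewrite /letter_at nth_nil.
rewrite addn_eq0 eqb0 /marked; split=> [/andP[l0 /IH w0] [|k]|H].
- by rewrite /letter_at /=; case: (l.2) l0.
- exact: w0.
- by rewrite (H 0) /=; apply/IH => k; apply: (H k.+1).
Qed.

Lemma count_marked1 (w : seq letter) :
  count marked w == 1 <-> exists p, marked_at w p.
Proof.
elim: w => [|l w IH] /=.
  by split=> // -[p /(_ p.1)]; rewrite eqxx /letter_at nth_nil.
case: l => b [q|] /=.
  rewrite add1n eqSS; split=> [/unmarkedP w0|[p wp]].
    by exists (0, q) => -[|k] //=; apply: w0.
  have p0 : p.1 = 0 by have := wp 0; case: eqP.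
  by apply/unmarkedP => k; rewrite [LHS](wp k.+1) p0.
rewrite add0n; split=> [/IH[p wp]|[p wp]].
  by exists (p.1.+1, p.2) => -[|k] //=; rewrite eqSS; apply: wp.
apply/IH; exists (p.1.-1, p.2) => k; rewrite [LHS](wp k.+1).
by case: p wp => [[|k'] q] wp //; have := wp 0.
Qed.

Lemma markerP w p : marked_at w p -> marker w = p.
Proof.
move=> wp; have hw : has marked w.
  by rewrite has_count (eqP ((count_marked1 w).2 (ex_intro _ p wp))).
have := nth_find empty_letter hw; rewrite /marked -/(letter_at _ _) wp.
by case: eqP => // E _; rewrite /marker wp E eqxx -surjective_pairing.
Qed.

Lemma marked_at_marker w : count marked w == 1 -> marked_at w (marker w).
Proof. by move=> /count_marked1[p wp]; rewrite (markerP wp). Qed.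

(** A word is extended by empty letters into a sequence of finite support; the
condition on the last letter makes its length a function of that support. *)
Lemma trimmed_eq w1 w2 : last empty_letter w1 != empty_letter ->
  last empty_letter w2 != empty_letter ->
  letter_at w1 =1 letter_at w2 -> w1 = w2.
Proof.
have le u v : last empty_letter u != empty_letter ->
    letter_at u =1 letter_at v -> size u <= size v.
  move=> lu uv; rewrite leqNgt; apply: contraNN lu => lt.
  by rewrite -nth_last [X in X == _]uv /letter_at nth_default //; lia.
move=> l1 l2 e12; apply: (@eq_from_nth _ empty_letter) => [|k _]; last exact: e12.
by apply/anti_leq; rewrite !le // => k; rewrite e12.
Qed.

Lemma exists_trimming w : exists u, letter_at u =1 letter_at w /\
  (u = [::] \/ last empty_letter u != empty_letter).
Proof.
elim/last_ind: w => [|w l [u [uw IH]]]; first by exists [::]; split=> //; left.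
have [->|l0] := eqVneq l empty_letter; last first.
  by exists (rcons w l); split=> //; right; rewrite last_rcons.
exists u; split=> // k; rewrite uw /letter_at nth_rcons.
by case: ltnP => // ge; rewrite nth_default // if_same.
Qed.

Local Open Scope group_scope.

Definition lamps (w : seq letter) : fin_supp Z2 ZZ :=
  [fsfun z in [fset z in [seq unsite (k, q) |
                          k <- iota 0 (size w), q <- enum {: quadrant}]]%fset =>
     (letter_at w (site z).1).1 (site z).2 : Z2 | 1].

Definition word_elt (w : seq letter) : wreath Z2 ZZ :=
  (lamps w, unsite (marker w)).

Lemma lampsE w z : lamps w z = (letter_at w (site z).1).1 (site z).2.
Proof.
rewrite /lamps /fin_supp_fun fsfunE; case: ifPn => // zw; symmetry.
suff ge : size w <= (site z).1 by rewrite /letter_at nth_default // ffunE.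
rewrite leqNgt; apply: contraNN zw => lt; rewrite !inE /=.
apply/allpairsP; exists (site z); split; rewrite ?mem_iota ?mem_enum //.
by rewrite -surjective_pairing siteK.
Qed.

Lemma lamps_eq w1 w2 :
  lamps w1 = lamps w2 <-> forall k, (letter_at w1 k).1 = (letter_at w2 k).1.
Proof.
split=> [e k|e]; last by apply: fs_eqP => z; rewrite !lampsE e.
apply/ffunP => q.
have : lamps w1 (unsite (k, q)) = lamps w2 (unsite (k, q)) by rewrite e.
by rewrite !lampsE unsiteK.
Qed.

Lemma word_elt_inj w1 w2 : normal_words w1 -> normal_words w2 ->
  word_elt w1 = word_elt w2 -> w1 = w2.
Proof.
move=> [c1 l1] [c2 l2] e12; apply: trimmed_eq => // k.
have /lamps_eq e := congr1 fst e12.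
have /(can_inj unsiteK) m := congr1 snd e12.
rewrite [LHS]surjective_pairing [RHS]surjective_pairing e.
by rewrite (marked_at_marker c1) (marked_at_marker c2) m.
Qed.

(** All lamps and the marker lie below a bound [N]; the word of length [N]
that lists the letters is then cut after its last nonempty letter. *)
Lemma word_elt_surj (u : wreath Z2 ZZ) :
  exists2 w, normal_words w & word_elt w = u.
Proof.
case: u => f b.
pose l k : letter := ([ffun q => f (unsite (k, q))],
                      if k == (site b).1 then Some (site b).2 else None).
pose N := (\max_(z <- (site b).1 :: [seq (site z).1 | z <- finsupp f]) z).+1.
have outN z : N <= (site z).1 -> f z = 1.
  apply: contraTeq; rewrite -ltnNge ltnS -mem_finsupp => zf.
  have : (site z).1 \in (site b).1 :: [seq (site z).1 | z <- finsupp f].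
    by apply/predU1P; right; apply: (map_f (fun z => (site z).1)).
  by move=> /(@leq_bigmax_seq _ _ xpredT id); apply.
have lN k : letter_at (mkseq l N) k = l k.
  rewrite /letter_at; case: (ltnP k N) => [lt|ge]; first by rewrite nth_mkseq.
  rewrite nth_default ?size_mkseq // /l; congr pair.
    by apply/ffunP => q; rewrite !ffunE outN // unsiteK.
  case: eqP => // kb; move: ge; rewrite kb /N ltnNge big_cons.
  by rewrite leq_maxl.
have [w [wl tw]] := exists_trimming (mkseq l N).
have wp : marked_at w (site b) by move=> k; rewrite wl lN.
have cw : count marked w == 1%N by apply/count_marked1; exists (site b).
exists w.
  by split=> //; case: tw cw => // ->.
congr pair; last by rewrite (markerP wp) siteK.
by apply: fs_eqP => z; rewrite lampsE wl lN ffunE -surjective_pairing siteK.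
Qed.

(** * Multiplication by the generators *)

Definition unit_vec (d : bool) : ZZ := if d then (0%R, 1%R) else (1%R, 0%R).

Definition negative (d : bool) (q : quadrant) : bool := if d then q.2 else q.1.

(** Coordinates are unsigned, so a unit step in direction [d] leads outwards in
a positive quadrant, inwards in a negative one, and keeps the cell exactly when
it enters the positive side from the negative side. *)
Definition adjacent (d : bool) (p p' : nat * quadrant) : Prop :=
  [/\ negative (~~ d) p.2 = negative (~~ d) p'.2,
      (p.1 == p'.1) = (negative d p.2 != negative d p'.2),
      negative d p'.2 ==> negative d p.2
    & if negative d p.2 then grid_step d p'.1 p.1 else grid_step d p.1 p'.1].

Lemma eq_cell a b a' b' :
  (cell a b == cell a' b') = (a == a') && (b == b').
Proof.
apply/eqP/andP => [e|[/eqP-> /eqP->]//].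
by have := congr1 uncell e; rewrite !cellK => -[-> ->].
Qed.

Lemma grid_step_cell d a b a' b' : grid_step d (cell a b) (cell a' b') <->
  (if d then a' = a /\ b' = b.+1 else a' = a.+1 /\ b' = b) \/
  a' = a /\ b' = b /\ (if d then b else a) = 0%N.
Proof.
split=> [[x [y [/eqP]]]|].
  rewrite eq_cell => /andP[/eqP-> /eqP->] [/eqP|[/eqP]].
    by case: d; rewrite eq_cell => /andP[/eqP-> /eqP->]; left.
  by rewrite eq_cell => /andP[/eqP-> /eqP->]; right.
move=> H; exists a, b; split=> //.
by case: d H => -[[-> ->]|[-> [-> ->]]]; auto.
Qed.

Lemma site_adjacent d z z' :
  z' = z * unit_vec d <-> adjacent d (site z) (site z').
Proof.
have mulE : z * unit_vec d =
    ((z.1 + (unit_vec d).1)%R, (z.2 + (unit_vec d).2)%R) by [].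
rewrite mulE /adjacent /site /= eq_cell.
rewrite !(boolp.propext (grid_step_cell _ _ _ _ _)).
case: z z' {mulE} => [i j] [i' j'] /=.
have -> : ((i', j') = ((i + (unit_vec d).1)%R, (j + (unit_vec d).2)%R) :> ZZ) <->
   (i' = i + (unit_vec d).1 /\ j' = j + (unit_vec d).2)%R.
  by split=> [[-> ->]|[-> ->]].
rewrite /unit_vec /negative.
case: d => /=; case: i => i; case: i' => i'; case: j => j; case: j' => j' /=.
all: by split=> [H|[]]; [split; lia | lia].
Qed.
Lemma word_elt_move d w1 w2 :
  word_elt w1 * wr_base Z2 (unit_vec d) = word_elt w2 <->
  (forall k, (letter_at w1 k).1 = (letter_at w2 k).1) /\
  adjacent d (marker w1) (marker w2).
Proof.
have -> : word_elt w1 * wr_base Z2 (unit_vec d) =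
    (lamps w1, unsite (marker w1) * unit_vec d).
  congr pair; apply: fs_eqP => z.
  by rewrite fs_mulE fs_shiftE fs_oneE mulg1.
have -> : adjacent d (marker w1) (marker w2) <->
    unsite (marker w2) = unsite (marker w1) * unit_vec d.
  by rewrite site_adjacent !unsiteK.
rewrite -lamps_eq; split=> [e|[e1 e2]]; last by rewrite /word_elt -e1 e2.
by split; [have := congr1 fst e | have := congr1 snd e].
Qed.

Lemma word_elt_toggle w1 w2 :
  word_elt w1 * gen_h = word_elt w2 <->
  marker w1 = marker w2 /\
  forall k q, (letter_at w2 k).1 q =
    ((letter_at w1 k).1 q + (if (k, q) == marker w1 then 1 else 0))%R.
Proof.
have lampE z : (word_elt w1 * gen_h).1 z =
    ((letter_at w1 (site z).1).1 (site z).2 +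
     (if site z == marker w1 then 1 else 0))%R.
  rewrite [LHS]fs_mulE fs_shiftE fs_singleE lampsE /=.
  congr (_ + _)%R.
  have -> : ((unsite (marker w1))^-1 * z == 1) = (site z == marker w1).
    rewrite mulg_eq1 (inj_eq (@invg_inj _)) eq_sym.
    by rewrite -[site z == _](can_eq unsiteK) siteK.
  by [].
have posE : (word_elt w1 * gen_h).2 = unsite (marker w1) by rewrite [LHS]mulg1.
split=> [e|[em e]].
  split; first by apply: (can_inj unsiteK); rewrite -posE e.
  move=> k q; have := lampE (unsite (k, q)).
  by rewrite e lampsE !unsiteK.
rewrite [LHS]surjective_pairing [RHS]surjective_pairing posE em; congr pair.
by apply: fs_eqP => z; rewrite lampE lampsE e -surjective_pairing.
Qed.

Lemma all_convolution (T : finType) (p : pred (option T * option T))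
    (w1 w2 : seq T) : all p (convolution w1 w2) <->
  forall k, k < maxn (size w1) (size w2) -> p (onth w1 k, onth w2 k).
Proof.
split=> [/allP H k lt|H].
  by apply: H; apply/mapP; exists k => //; rewrite mem_iota.
by apply/allP => a /mapP[k]; rewrite mem_iota => lt ->; apply: H.
Qed.

Definition padded (u : option letter) : letter := odflt empty_letter u.

Lemma padded_onth w k : padded (onth w k) = letter_at w k.
Proof. exact: odflt_onth. Qed.

(** The parameter [i] is the pair of quadrants of the two markers.  The
last condition says, letter by letter, that the markers share a cell exactly when the
step crosses the axis. *)
Definition move_ok (d : bool) (i : quadrant * quadrant)
    (a : option letter * option letter) : bool :=
  let u := padded a.1 in let v := padded a.2 in
  [&& u.1 == v.1,
      u.2 \in [:: None; Some i.1], v.2 \in [:: None; Some i.2],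
      negative (~~ d) i.1 == negative (~~ d) i.2,
      negative d i.2 ==> negative d i.1
    & marked u || marked v ==>
      ((marked u && marked v) == (negative d i.1 != negative d i.2))].

(** The near and far markers of the skeleton: on the negative side the step
leads inwards, so the first word carries the far marker. *)
Definition move_marks (d : bool) (a : option letter * option letter) :
    bool * bool :=
  let u := padded a.1 in let v := padded a.2 in
  let q := odflt (odflt (false, false) v.2) u.2 in
  if negative d q then (marked v, marked u) else (marked u, marked v).

(** The word [marks i j n] determines [i] and [j], as both positions occur
in it. *)
Lemma skeleton_marks E i j n : i < n -> j < n ->
  skeleton E (marks i j n) <-> E i j.
Proof.
move=> lt_i lt_j; split=> [[i' [j' [n' [Eij lt_i' lt_j' e]]]]|]; last first.
  by exists i, j, n.
have nn : n' = n by have := congr1 size e; rewrite !size_mkseq.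
rewrite nn in lt_i' lt_j' e.
have := congr1 (fun s => (nth (false, false) s i).1) e.
have := congr1 (fun s => (nth (false, false) s j).2) e.
by rewrite !nth_mkseq //= !eqxx => /esym/eqP-> /esym/eqP->.
Qed.

Lemma marker_lt w : normal_words w -> (marker w).1 < size w.
Proof. by move=> [c _]; rewrite -has_find has_count (eqP c). Qed.

Lemma move_ok_pair d w1 w2 : normal_words w1 -> normal_words w2 ->
  (exists i, all (move_ok d i) (convolution w1 w2)) <->
  [/\ forall k, (letter_at w1 k).1 = (letter_at w2 k).1,
      negative (~~ d) (marker w1).2 = negative (~~ d) (marker w2).2,
      ((marker w1).1 == (marker w2).1) =
        (negative d (marker w1).2 != negative d (marker w2).2)
    & negative d (marker w2).2 ==> negative d (marker w1).2].
Proof.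
move=> t1 t2; have := marker_lt t1; have := marker_lt t2.
have := marked_at_marker t1.1; have := marked_at_marker t2.1.
case: (marker w1) (marker w2) => [k1 q1] [k2 q2] /= m2 m1 lt2 lt1.
split=> [[[i1 i2] /all_convolution ok]|[bits side turn sign]].
  have := ok k2; rewrite leq_max lt2 orbT => /(_ isT).
  rewrite /move_ok !padded_onth m2 eqxx !inE /= => /and5P[_ _ /eqP[q2E] _ _].
  have := ok k1; rewrite leq_max lt1 => /(_ isT).
  rewrite /move_ok !padded_onth /marked m1 m2 eqxx !inE /= -q2E.
  move=> /and5P[_ /eqP[<-] _ /eqP-> /andP[-> /eqP turn]].
  split=> // [k|]; last by rewrite -turn; case: eqP.
  case: (ltnP k (maxn (size w1) (size w2))) => [/ok|].
    by rewrite /move_ok !padded_onth => /andP[/eqP].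
  by rewrite geq_max => /andP[ge1 ge2]; rewrite /letter_at !nth_default.
exists (q1, q2); apply/all_convolution => k _.
rewrite /move_ok !padded_onth /marked m1 m2 bits side sign !eqxx /= -turn !inE.
have [->|n1] := eqVneq k k1; first by case: (k1 == k2); rewrite /= ?eqxx ?orbT.
have [E|] := eqVneq k k2; last by [].
by rewrite E eq_sym in n1; rewrite (negPf n1) /= eqxx.
Qed.

Lemma move_marks_convolution d w1 w2 : normal_words w1 -> normal_words w2 ->
  ((marker w1).1 == (marker w2).1) =
        (negative d (marker w1).2 != negative d (marker w2).2) ->
  map (move_marks d) (convolution w1 w2) =
  if negative d (marker w1).2
  then marks (marker w2).1 (marker w1).1 (maxn (size w1) (size w2))
  else marks (marker w1).1 (marker w2).1 (maxn (size w1) (size w2)).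
Proof.
move=> t1 t2; have := marked_at_marker t1.1; have := marked_at_marker t2.1.
case: (marker w1) (marker w2) => [k1 q1] [k2 q2] /= m2 m1 turn.
have -> : (if negative d q1 then marks k2 k1 (maxn (size w1) (size w2))
    else marks k1 k2 (maxn (size w1) (size w2))) =
    mkseq (fun k => if negative d q1 then (k == k2, k == k1)
                    else (k == k1, k == k2)) (maxn (size w1) (size w2)).
  by case: ifP.
rewrite -map_comp; apply: eq_map => k /=.
rewrite /move_marks !padded_onth /marked m1 m2.
have [->|n1] := eqVneq k k1; first by case: (k1 == k2).
have [E|_] := eqVneq k k2; last by case: ifP; case: ifP.
move: turn; rewrite -E eq_sym (negPf n1) /= => /esym/negbFE/eqP->.
by case: ifP.
Qed.

Lemma regular_normal_words : regular_language normal_words.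
Proof.
apply: regular_setI; first exact: regular_count1.
exact: (regular_last _ (predC1 _)).
Qed.

Lemma indexed_cayley_move d :
  indexed_language
    (cayley_language normal_words word_elt (wr_base Z2 (unit_vec d))).
Proof.
apply: (indexed_cayley_language (p := move_ok d) (proj := move_marks d)
  regular_normal_words (indexed_skeleton d)) => w1 w2 t1 t2 /=.
have lt1 : (marker w1).1 < maxn (size w1) (size w2).
  by rewrite leq_max marker_lt.
have lt2 : (marker w2).1 < maxn (size w1) (size w2).
  by rewrite leq_max (marker_lt t2) orbT.
rewrite move_ok_pair // word_elt_move; split.
  move=> [bits [side turn sign step]]; split=> //.
  rewrite move_marks_convolution //.
  by case: ifP step => _; rewrite skeleton_marks.
move=> [[bits side turn sign]]; rewrite move_marks_convolution // => step.
by split=> //; split=> //; case: ifP step => _; rewrite skeleton_marks.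
Qed.

Definition toggle_ok (q : quadrant) (a : option letter * option letter) : bool :=
  let u := padded a.1 in let v := padded a.2 in
  [&& u.2 == v.2, u.2 \in [:: None; Some q]
    & [forall r, v.1 r == (u.1 r + (if marked u && (r == q) then 1 else 0))%R]].

Lemma indexed_cayley_toggle :
  indexed_language (cayley_language normal_words word_elt gen_h).
Proof.
have K : indexed_language
    [set w : seq unit | exists i : unit, all ((fun=> xpredT) i) w]%classic.
  exact/regular_indexed/regular_exists_all.
apply: (indexed_cayley_language (p := toggle_ok) (proj := fun=> tt)
  regular_normal_words K) => w1 w2 t1 t2 /=.
rewrite word_elt_toggle; have m1 := marked_at_marker t1.1.
have m2 := marked_at_marker t2.1; have lt1 := marker_lt t1.
split=> [[em e]|[[q /all_convolution ok] _]].
  split; last by exists tt; apply/allP.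
  rewrite -em in m2; case: (marker w1) m1 m2 e => [k1 q1] /= m1 m2 e {em lt1}.
  exists q1; apply/all_convolution => k _.
  rewrite /toggle_ok !padded_onth /marked m2 m1 eqxx /= !inE.
  apply/andP; split; first by case: ifP; rewrite ?eqxx ?orbT.
  by apply/forallP => r; rewrite e xpair_eqE; case: (k == _).
have out k : maxn (size w1) (size w2) <= k ->
    letter_at w1 k = empty_letter /\ letter_at w2 k = empty_letter.
  by rewrite geq_max => /andP[ge1 ge2]; rewrite /letter_at !nth_default.
have mm : marked_at w2 (marker w1).
  move=> k; rewrite -m1.
  have [/ok|/out[-> ->] //] := ltnP k (maxn (size w1) (size w2)).
  by rewrite /toggle_ok !padded_onth => /and3P[/eqP->].
have mq : (marker w1).2 = q.
  have := ok (marker w1).1; rewrite leq_max lt1 => /(_ isT).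
  by rewrite /toggle_ok !padded_onth m1 eqxx !inE => /and3P[_ /eqP[]].
split=> [|k r]; first by rewrite (markerP mm).
rewrite [marker w1]surjective_pairing xpair_eqE mq.
have [/ok|ge] := ltnP k (maxn (size w1) (size w2)).
  rewrite /toggle_ok !padded_onth /marked m1 => /and3P[_ _ /forallP/(_ r)/eqP->].
  by case: (k == _).
have [-> ->] := out k ge; rewrite ffunE.
have /negPf-> : k != (marker w1).1.
  by apply: contraTneq ge => ->; rewrite -ltnNge leq_max lt1.
by rewrite GRing.addr0.
Qed.

(** * Generation and conclusion *)

(** The powers of x and y give all translations; conjugating h by a
translation gives any single lamp, and multiplying by the lamp at a point of
the support of f removes this point, whence an induction on the support. *)
Lemma wreath_generators :
  generates [fset gen_x; gen_y; gen_h]%fset.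
Proof.
move=> H H1 Hdiv HS.
have HV u : H u -> H u^-1 by move=> Hu; rewrite -[u^-1]mul1g; apply: Hdiv.
have HM u v : H u -> H v -> H (u * v).
  by move=> Hu Hv; rewrite -[v]invgK; apply: Hdiv => //; apply: HV.
have Hx : H gen_x by apply: HS; do 2![apply/fsetUP; left]; apply: fset11.
have Hy : H gen_y by apply: HS; apply/fsetUP; left; apply/fsetUP; right; apply: fset11.
have Hh : H gen_h by apply: HS; apply/fsetUP; right; apply: fset11.
have baseM b c : wr_base Z2 (b * c) = wr_base Z2 b * wr_base Z2 c :> wreath Z2 ZZ.
  by congr pair; apply: fs_eqP => z; rewrite fs_mulE fs_shiftE !fs_oneE mulg1.
have baseV b : wr_base Z2 b^-1 = (wr_base Z2 b)^-1 :> wreath Z2 ZZ.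
  by apply: (mulgI (wr_base Z2 b)); rewrite -baseM !mulgV.
pose P := fun b : ZZ => H (wr_base Z2 b).
have PD b c : P b -> P c -> P (b * c) by rewrite /P baseM; apply: HM.
have PV b : P b -> P b^-1 by rewrite /P baseV; apply: HV.
have P1 : P 1 by [].
have P10 (i : int) : P (i, 0%R).
  have pos n : P (Posz n, 0%R).
    elim: n => // n IH; have := PD _ _ IH Hx.
    by congr (P (_, _)); rewrite /= ?GRing.addr0; lia.
  case: i => n //; have := PV _ (pos n.+1).
  by congr (P (_, _)); lia.
have P01 (i : int) : P (0%R, i).
  have pos n : P (0%R, Posz n).
    elim: n => // n IH; have := PD _ _ IH Hy.
    by congr (P (_, _)); rewrite /= ?GRing.addr0; lia.
  case: i => n //; have := PV _ (pos n.+1).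
  by congr (P (_, _)); lia.
have Hbase b : P b.
  have := PD _ _ (P10 b.1) (P01 b.2); case: b => i j.
  by congr (P (_, _)) => /=; lia.
pose at_origin (f : fin_supp Z2 ZZ) : wreath Z2 ZZ := (f, 1).
have suppE (f : fin_supp Z2 ZZ) y : (y \in finsupp f) = (f y != 1).
  by rewrite mem_finsupp.
have Hlamps n (f : fin_supp Z2 ZZ) : #|` finsupp f| <= n -> H (at_origin f).
  elim: n f => [|n IH] f.
    rewrite leqn0 cardfs_eq0 => /eqP f0.
    suff -> : f = 1 by [].
    by apply: fs_eqP => z; rewrite fs_oneE; apply/eqP; rewrite -memNfinsupp f0.
  move=> szf; have [f0|[z zf]] := fset_0Vmem (finsupp f).
    by apply: IH; rewrite f0.
  have [lamp Hlamp lampE] : exists2 lamp, H lamp &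
      lamp = (fs_shift (fs_single ZZ (1%R : Z2)) z^-1, 1).
    exists (wr_base Z2 z * gen_h * (wr_base Z2 z)^-1).
      by apply: (HM); [apply: (HM)|apply: (HV)] => //; apply: (Hbase).
    rewrite -baseV; congr pair; last by rewrite /= mulg1 mulgV.
    by apply: fs_eqP => y; rewrite !(fs_mulE, fs_shiftE, fs_oneE) mulg1 mul1g.
  have lampyE y : lamp.1 y = if y == z then (1%R : Z2) else 1.
    by rewrite lampE fs_shiftE fs_singleE mulg_eq1 (inj_eq (@invg_inj _)) eq_sym.
  have fz : f z = (1%R : Z2).
    have : f z != 1 by rewrite -suppE.
    by case: (f z) => [[|[|m]] lt] // _; apply: val_inj.
  have [g gE] : exists g : fin_supp Z2 ZZ, forall y, g y = if y == z then 1 else f y.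
    exists (f * lamp.1) => y; rewrite fs_mulE lampyE.
    by case: eqP => [->|_]; [rewrite fz; apply: val_inj | rewrite mulg1].
  have -> : at_origin f = at_origin g * lamp.
    congr pair; last by rewrite lampE /= mulg1.
    apply: fs_eqP => y; rewrite fs_mulE fs_shiftE invg1 mul1g gE lampyE.
    by case: eqP => [->|_]; [rewrite fz mul1g | rewrite mulg1].
  apply: (HM) => //; apply: IH; rewrite -ltnS; apply: leq_trans szf.
  apply: fproper_ltn_card; rewrite fproperE; apply/andP; split.
    by apply/fsubsetP => y; rewrite !suppE gE; case: ifP => //; rewrite eqxx.
  by apply/fsubsetPn; exists z => //; rewrite suppE gE eqxx eqxx.
apply/seteqP; split=> // -[f b] _.
have -> : (f, b) = at_origin f * wr_base Z2 b.
  congr pair; last by rewrite /= mul1g.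
  by apply: fs_eqP => z; rewrite fs_mulE fs_shiftE fs_oneE mulg1.
by apply: (HM); [apply: (Hlamps _ f (leqnn _))|apply: Hbase].
Qed.

Theorem theorem8 :
  exists (Sigma : finType) (L : set (seq Sigma))
         (psi : seq Sigma -> wreath Z2 ZZ),
    indexed_cayley_representation [fset gen_x; gen_y; gen_h]%fset L psi
    /\ regular_language L.
Proof.
exists letter, normal_words, word_elt; split; last exact: regular_normal_words.
split.
- exact: wreath_generators.
- exact/regular_indexed/regular_normal_words.
- split=> // [w1 w2|u _].
    by rewrite !inE; apply: word_elt_inj.
  by have [w tw <-] := word_elt_surj u; exists w.
- move=> s /fsetUP[/fsetUP[]|] /fset1P->.
  + exact: (indexed_cayley_move false).
  + exact: (indexed_cayley_move true).
  + exact: indexed_cayley_toggle.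
Qed.
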